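(* Let $M=(m_{ij})$ be a symmetric (entrywise) nonnegative real matrix of order $n$ with eigenvalues $\rho_1,\rho_2,\dots,\rho_n$, let $s_i=\sum_{j=1}^n m_{ij}$ be its row sums, and let $r=\min\{s_i : i=1,\dots,n\}$. Then $$EE(M)\geq e^{r}+\operatorname{Tr}(M)+(n-1)-r.$$
   Context: For a real symmetric matrix $M$ of order $n$ with eigenvalues $\rho_1,\dots,\rho_n$ (with multiplicity), the Estrada index of $M$ is $EE(M)=\sum_{i=1}^n e^{\rho_i}$. The eigenvalues are indexed so that $|\rho_i|\leq\rho_1$ for all $i$. $\operatorname{Tr}(M)$ is the trace of $M$. *)

(* Defs.v *)
From HB Require Import structures.
From mathcomp Require Import all_boot all_order all_algebra.
From mathcomp Require Import complex.
From mathcomp Require Import boolp classical_sets reals sequences exp.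
Set Implicit Arguments.
Unset Strict Implicit.
Unset Printing Implicit Defensive.
Import Order.TTheory GRing.Theory Num.Theory.
Local Open Scope ring_scope.

Section EstradaIndex.
Variable R : realType.
Implicit Types n : nat.

Definition is_spectrum n (M : 'M[R]_n) (rho : 'I_n -> R) : Prop :=
  char_poly M = \prod_(i < n) ('X - (rho i)%:P).

(* The order of the family is left unspecified.  If the characteristic
   polynomial of M does not split over R, the family is identically 0; this
   does not happen for a symmetric M, see eigenvaluesP. *)
Definition eigenvalues n (M : 'M[R]_n) : 'I_n -> R :=
  xget (fun=> 0) (is_spectrum M).

Definition estrada_index n (M : 'M[R]_n) : R :=
  \sum_(i < n) expR (eigenvalues M i).

Definition row_sum n (M : 'M[R]_n) (i : 'I_n) : R := \sum_(j < n) M i j.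

Definition min_row_sum n (M : 'M[R]_n.+1) : R :=
  \big[Num.min/row_sum M ord0]_(i < n.+1) row_sum M i.

Lemma symmetric_spectrum_exists n (M : 'M[R]_n) :
  M^T = M -> exists rho, is_spectrum M rho.
Proof.
move=> symM; pose f := real_complex R; pose A := map_mx f M.
have realA : A \is a mxOver Num.real.
  apply/mxOverP => i j; rewrite mxE /f; apply/complex_realP.
  by exists (M i j).
have hermA : A \is hermsymmx.
  apply: realsym_hermsym => //; apply/is_hermitianmxP.
  rewrite expr0 scale1r; apply/matrixP => i j; rewrite !mxE /=.
  by rewrite -{1}symM mxE.
have /orthomx_spectralP specA := hermitian_normalmx hermA.
set P := spectralmx A in specA; set d := spectral_diag A in specA.
have Pu : P \in unitmx by exact: spectral_unit.
have charA : char_poly A = \prod_(i < n) ('X - (d 0 i)%:P).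
  rewrite specA /char_poly /char_poly_mx !map_mxM.
  have PVP : map_mx polyC (invmx P) *m map_mx polyC P = 1%:M :> 'M[{poly R[i]}]_n.
    by rewrite -map_mxM mulVmx // map_mx1.
  have -> : 'X%:M = map_mx polyC (invmx P) *m 'X%:M *m map_mx polyC P
      :> 'M[{poly R[i]}]_n.
    by rewrite scalar_mxC -mulmxA PVP mulmx1.
  rewrite -mulmxBl -mulmxBr !det_mulmx mulrAC -det_mulmx PVP det1 mul1r.
  rewrite -/(char_poly_mx (diag_mx d)) -/(char_poly (diag_mx d)).
  rewrite char_poly_trig ?diag_mx_is_trig //.
  by apply: eq_bigr => i _; rewrite mxE eqxx.
have /mxOverP reald := hermitian_spectral_diag_real hermA.
have dE i : d 0 i = f (complex.Re (d 0 i)).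
  by have /complex_realP[x ->] := reald 0 i.
exists (fun i => complex.Re (d 0 i)); rewrite /is_spectrum.
apply: (@map_poly_inj _ _ f); rewrite map_char_poly -/A charA rmorph_prod.
by apply: eq_bigr => i _; rewrite rmorphB /= map_polyX map_polyC {1}dE.
Qed.

Lemma eigenvaluesP n (M : 'M[R]_n) :
  M^T = M -> is_spectrum M (eigenvalues M).
Proof. by move=> /symmetric_spectrum_exists; exact: xgetPex. Qed.

Lemma estrada_indexE n (M : 'M[R]_n) (rho : 'I_n -> R) :
  is_spectrum M rho -> estrada_index M = \sum_(i < n) expR (rho i).
Proof.
move=> Mrho.
have Mev : is_spectrum M (eigenvalues M) by apply: xgetPex; exists rho.
have prodE (g : 'I_n -> R) : \prod_(i < n) ('X - (g i)%:P) =
    \prod_(x <- [seq g i | i <- enum 'I_n]) ('X - x%:P) :> {poly R}.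
  by rewrite big_map big_enum.
have sumE (g : 'I_n -> R) : \sum_(i < n) expR (g i) =
    \sum_(x <- [seq g i | i <- enum 'I_n]) expR x.
  by rewrite big_map big_enum.
rewrite /estrada_index !sumE; apply: perm_big.
by apply: prod_XsubC_eq; rewrite -!prodE -Mrho -Mev.
Qed.

End EstradaIndex.

(* Main.v *)
Require Import Defs.
From mathcomp Require Import all_boot all_order all_algebra.
From mathcomp Require Import complex.
From mathcomp Require Import reals sequences exp.
From mathcomp Require Import lra.
Import Order.TTheory GRing.Theory Num.Theory.
Local Open Scope ring_scope.

(** Since [M] is symmetric, its largest eigenvalue [rho] dominates the Rayleigh
    quotient of the all-ones vector, which is the average of the row sums; hence
    [rho >= r >= 0].  Bounding [expR x] below by [1 + x] at all other
    eigenvalues gives [EE(M) >= expR rho - rho + \tr M + (n - 1)], and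
    [expR x - x] is nondecreasing on nonnegative reals. *)

Section SymmetricMatrix.
Set Implicit Arguments.
Unset Strict Implicit.
Variable R : realType.

(** Up to sign, both sides are the coefficient of ['X^n] in the characteristic polynomial. *)
Lemma spectrum_trace n (M : 'M[R]_n.+1) (rho : 'I_n.+1 -> R) :
  is_spectrum M rho -> \tr M = \sum_i rho i.
Proof.
move=> Mrho; apply: oppr_inj; rewrite -char_poly_trace // Mrho.
pose s := [seq rho i | i <- enum 'I_n.+1].
have sz : size s = n.+1 by rewrite size_map size_enum_ord.
have -> : \prod_(i < n.+1) ('X - (rho i)%:P) = \prod_(x <- s) ('X - x%:P).
  by rewrite big_map big_enum.
by rewrite -{1}sz coefPn_prod_XsubC ?sz // big_map big_enum.
Qed.

(** After passing to [R[i]], [M] is unitarily diagonalizable. In the coordinates [w] of [v] along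
    the eigenbasis, both forms become sums weighted by the squared moduli of the [w 0 i], and are
    compared term by term. *)
Lemma rayleigh_le n (M : 'M[R]_n) (rho : 'I_n -> R) (c : R) (v : 'rV[R]_n) :
  M^T = M -> is_spectrum M rho -> (forall i, rho i <= c) ->
  (v *m M *m v^T) 0 0 <= c * (v *m v^T) 0 0.
Proof.
move=> symM Mrho rho_le; pose f := real_complex R; pose A := map_mx f M.
have realA : A \is a mxOver Num.real.
  by apply/mxOverP => i j; rewrite mxE; apply/complex_realP; exists (M i j).
have hermA : A \is hermsymmx.
  apply: realsym_hermsym => //; apply/is_hermitianmxP.
  rewrite expr0 scale1r; apply/matrixP => i j.
  by rewrite !mxE /= -[in LHS]symM mxE.
have /orthomx_spectralP := hermitian_normalmx hermA.
set P := spectralmx A; set d := spectral_diag A => specA.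
have Pun : P \is unitarymx := spectral_unitarymx A.
have Pu : P \in unitmx := spectral_unit A.
(* Row [i] of [P] is an eigenvector for [d 0 i], nonzero as [P] is invertible. Hence [d 0 i] is a
   root of the characteristic polynomial, that is, the image of some [rho j]. *)
have d_le i : d 0 i <= f c.
  have : eigenvalue A (d 0 i).
    apply/eigenvalueP; exists (row i P).
      rewrite -row_mul {1}specA !mulmxA mulmxV // mul1mx row_mul.
      by rewrite row_diag_mx -scalemxAl -rowE.
    apply/eqP => Pi0; have := congr1 (mulmx^~ (invmx P)) Pi0.
    rewrite -row_mul mulmxV // mul0mx => /rowP /(_ i) /eqP.
    by rewrite !mxE eqxx oner_eq0.
  rewrite eigenvalue_root_char -map_char_poly Mrho map_prod_XsubC.
  rewrite -(big_map (fun i => f (rho i)) predT (fun x => 'X - x%:P)).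
  rewrite root_prod_XsubC => /mapP[j _ ->].
  by rewrite /f lecR.
pose u := map_mx f v; pose w := u *m invmx P.
have uE : u = w *m P by rewrite mulmxKV.
(* As [P] is unitary, [w] is [u] times the conjugate transpose of [P]. Take conjugate transposes:
   [u] is fixed by conjugation, its entries being real. *)
have wJ : P *m u^T = map_mx Num.conj w^T.
  rewrite /w invmx_unitary // trmx_mul map_mxM.
  congr (_ *m _); apply/matrixP => i j; rewrite !mxE /= ?conjCK //.
  by rewrite conj_Creal //; apply/complex_realP; exists (v j i).
have quadA : (u *m A *m u^T) 0 0 = \sum_i d 0 i * (w 0 i * Num.conj (w 0 i)).
  rewrite specA !mulmxA -/w -mulmxA wJ mxE; apply: eq_bigr => i _.
  by rewrite mul_mx_diag !mxE mulrAC mulrC mulrA.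
have quad1 : (u *m u^T) 0 0 = \sum_i w 0 i * Num.conj (w 0 i).
  rewrite {1}uE -mulmxA wJ mxE; apply: eq_bigr => i _.
  by rewrite !mxE.
suff : f ((v *m M *m v^T) 0 0) <= f (c * (v *m v^T) 0 0) by rewrite lecR.
have -> : f ((v *m M *m v^T) 0 0) = (u *m A *m u^T) 0 0.
  by rewrite /u /A map_trmx -!map_mxM [RHS]mxE.
have -> : f (c * (v *m v^T) 0 0) = f c * (u *m u^T) 0 0.
  by rewrite /u map_trmx -map_mxM [X in _ = _ * X]mxE; exact: (rmorphM f).
rewrite quadA quad1 mulr_sumr; apply: ler_sum => i _.
by apply: ler_wpM2r => //; exact: mul_conjC_ge0.
Qed.

Lemma min_row_sum_le_eigenvalue n (M : 'M[R]_n.+1) (rho : 'I_n.+1 -> R) :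
  M^T = M -> is_spectrum M rho -> exists i, min_row_sum M <= rho i.
Proof.
move=> symM Mrho; pose k := [arg max_(i > ord0) rho i]%O; exists k.
have rho_le i : rho i <= rho k by rewrite /k; case: arg_maxP => // j _; apply.
pose e : 'rV[R]_n.+1 := const_mx 1.
have := rayleigh_le e symM Mrho rho_le.
have -> : (e *m e^T) 0 0 = n.+1%:R.
  rewrite mxE (eq_bigr (fun=> 1)) ?sumr_const ?card_ord //.
  by move=> i _; rewrite !mxE mulr1.
have -> : (e *m M *m e^T) 0 0 = \sum_i row_sum M i.
  rewrite -mulmxA mxE; apply: eq_bigr => i _.
  by rewrite !mxE mul1r; apply: eq_bigr => j _; rewrite !mxE mulr1.
have sum_ge : n.+1%:R * min_row_sum M <= \sum_i row_sum M i.
  rewrite mulr_natl -[n.+1 in leLHS]card_ord -sumr_const.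
  by apply: ler_sum => i _; exact: bigmin_le.
by move=> /(le_trans sum_ge); rewrite [leRHS]mulrC ler_pM2l.
Qed.

Lemma min_row_sum_ge0 n (M : 'M[R]_n.+1) :
  (forall i j, 0 <= M i j) -> 0 <= min_row_sum M.
Proof.
move=> M_ge0.
(* The initial value of the iterated minimum is itself a row sum, so both goals are sums of
   nonnegative entries. *)
by apply: le_bigmin => [|i _]; apply: sumr_ge0.
Qed.

(** With [a = expR x >= 1] and [b = expR (y - x) >= 1 + (y - x)], the increment [a * b - a] of the
    exponential is at least [a * (y - x)], hence at least [y - x]. *)
Lemma expR_subr_homo (x y : R) : 0 <= x -> x <= y -> expR x - x <= expR y - y.
Proof.
move=> x0 xy; rewrite -[y](subrKC x) expRD.
have := expR_ge1Dx (y - x); have := expR_ge1Dx x.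
set a := expR x; set b := expR (y - x) => ha hb.
have a1 : 1 <= a by rewrite (le_trans _ ha) // lerDl.
have dx : 0 <= y - x by rewrite subr_ge0.
have : a * (1 + (y - x)) <= a * b by rewrite ler_wpM2l // (le_trans ler01).
have : y - x <= a * (y - x) by rewrite ler_peMl.
nra.
Qed.

End SymmetricMatrix.

Theorem theorem6 (R : realType) (n : nat) (M : 'M[R]_n.+1) :
  M^T = M -> (forall i j, 0 <= M i j) ->
  estrada_index M >=
    expR (min_row_sum M) + \tr M + (n.+1%:R - 1) - min_row_sum M.
Proof.
move=> symM M_ge0; have Mrho := eigenvaluesP symM.
set rho := eigenvalues M in Mrho.
have [k r_le] := min_row_sum_le_eigenvalue symM Mrho.
have homo := expR_subr_homo (min_row_sum_ge0 M_ge0) r_le.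
have others : \sum_(i | i != k) (1 + rho i) <= \sum_(i | i != k) expR (rho i).
  by apply: ler_sum => i _; exact: expR_ge1Dx.
(* The ones add up to [n], one for each index other than [k]; this is the term [n.+1%:R - 1] of the
   goal. *)
rewrite big_split /= sumr_const cardC1 card_ord in others.
rewrite (spectrum_trace Mrho) (estrada_indexE Mrho).
(* With the [k]-th terms of the trace and of the index split off, the goal is the sum of [homo] and
   [others]. *)
rewrite [X in _ + X + _ - _](bigD1 k) // [leRHS](bigD1 k) //=.
rewrite -natr1 addrK; lra.
Qed.
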